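(* The sequence of Lidstone polynomials $(\Lambda_{t,1})_{t\in 2\mathbb{N}}$ is determined by $\Lambda_{0,1}(z)=z$ and $$ \Lambda_{t,1}''=\Lambda_{t-2,1}\quad\text{for all even } t\ge 2, $$ with the initial conditions $\Lambda_{t,1}(0)=\Lambda_{t,1}(1)=0$ for all $t\in 2\mathbb{N}$, $t\ge 2$. More precisely, the sequence $(\Lambda_{t,1})_{t\in 2\mathbb{N}}$ satisfies these conditions, and if $(L_t)_{t\in 2\mathbb{N}}$ is any sequence of polynomials in $\mathbb{C}[z]$ satisfying $L_0(z)=z$, $L_t''=L_{t-2}$ for all $t\in 2\mathbb{N}$ with $t\ge 2$, and $L_t(0)=L_t(1)=0$ for all $t\in 2\mathbb{N}$ with $t\ge 2$, then $L_t=\Lambda_{t,1}$ for all $t\in 2\mathbb{N}$.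
   Context: $2\mathbb{N}=\{0,2,4,\dots\}$ denotes the set of even nonnegative integers, and $f^{(\tau)}$ denotes the $\tau$-th derivative of $f$. For each $t\in 2\mathbb{N}$, the Lidstone polynomial $\Lambda_{t,1}\in\mathbb{C}[z]$ is the unique polynomial satisfying $\Lambda_{t,1}^{(\tau)}(0)=0$ and $\Lambda_{t,1}^{(\tau)}(1)=\delta_{t,\tau}$ (Kronecker symbol) for all $\tau\in 2\mathbb{N}$. *)

(* Defs.v *)
From HB Require Import structures.
From mathcomp Require Import all_boot all_order all_algebra.
From mathcomp Require Import boolp classical_sets reals.
From mathcomp Require Import complex.

Set Implicit Arguments.
Unset Strict Implicit.
Unset Printing Implicit Defensive.

Import Order.TTheory GRing.Theory Num.Theory.
Local Open Scope ring_scope.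

Definition is_Lidstone (R : realType) (t : nat) (p : {poly R[i]}) : Prop :=
  forall tau : nat, ~~ odd tau ->
    p^`(tau).[0] = 0 /\ p^`(tau).[1] = (t == tau)%:R.

(* The definite description: the unique polynomial with the interpolation
   property above.  The default value 0 is returned only if there were no
   such polynomial or several of them; only even t are meaningful. *)
Definition Lidstone (R : realType) (t : nat) : {poly R[i]} :=
  xget 0 [set p : {poly R[i]} | unique (@is_Lidstone R t) p]%classic.

(* A sequence indexed by the even nonnegative integers is encoded as a function
   on nat; its values at odd indices are unconstrained and never used. *)
Definition Lidstone_conditions (R : realType) (L : nat -> {poly R[i]}) : Prop :=
  [/\ L 0%N = 'X,
      forall t : nat, ~~ odd t -> (2 <= t)%N -> (L t)^`(2) = L (t - 2)%N
    & forall t : nat, ~~ odd t -> (2 <= t)%N ->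
        (L t).[0] = 0 /\ (L t).[1] = 0].

(* Main.v *)
Require Import Defs.
From HB Require Import structures.
From mathcomp Require Import all_boot all_order all_algebra.
From mathcomp Require Import boolp classical_sets reals.
From mathcomp Require Import complex.

Set Implicit Arguments.
Unset Strict Implicit.
Unset Printing Implicit Defensive.

Import Order.TTheory GRing.Theory Num.Theory.
Local Open Scope ring_scope.

(** Both characterizations of the Lidstone polynomials express the same
    recursion.  Splitting the even orders into 0 and those of the form
    tau + 2, the interpolation conditions of index t + 2 on p say exactly that
    p vanishes at 0 and 1 and that p'' satisfies the interpolation conditions
    of index t ([is_LidstoneSS]); those of index 0 hold for z.  By induction, a
    sequence satisfying the recursion consists of solutions of the
    interpolation problem, and conversely two derivatives of the solution of
    index t + 2 give a solution of index t.

    What remains is that the interpolation problem is well posed.  Existence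
    also follows from the recursion, because in characteristic 0 the boundary
    value problem q'' = p, q(0) = q(1) = 0 has a polynomial solution
    ([dirichlet_exists]).  For uniqueness, a polynomial all of whose even
    derivatives vanish at 0 and 1 is zero ([even_derivs_eq0]): by induction on
    the degree its second derivative is zero, so that it is an affine function
    vanishing at two points. *)

Section BoundaryValue.

Variable F : numFieldType.
Implicit Types p q : {poly F}.

Lemma derivn2_derivn p tau : p^`(2)^`(tau) = p^`(tau.+2).
Proof. by rewrite !derivSn derivn0. Qed.

Lemma antideriv_exists p : exists q, q^`() = p.
Proof.
(* At i = 0 the coefficient is p`_0 / 0 = 0, a harmless integration constant. *)
exists (\poly_(i < (size p).+1) (p`_i.-1 / i%:R)).
apply/polyP => i; rewrite coef_deriv coef_poly ltnS /=.
case: ltnP => [_|le_pi]; last by rewrite mul0rn nth_default.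
by rewrite -mulrnAr -[X in _ * X]mulr_natr mulVf ?mulr1 ?pnatr_eq0.
Qed.

(** Subtract from any second antiderivative of p the affine function with the
    same values at 0 and 1: this does not change the second derivative. *)
Lemma dirichlet_exists p :
  exists q, [/\ q^`(2) = p, q.[0] = 0 & q.[1] = 0].
Proof.
have [p1 <-] := antideriv_exists p; have [q <-] := antideriv_exists p1.
exists (q - (q.[1] - q.[0]) *: 'X - (q.[0])%:P).
split; last 2 first.
- by rewrite !hornerE subr0 subrr.
- by rewrite !hornerE subKr subrr.
by rewrite derivSn derivn1 !derivB derivZ derivX !derivC derivZ derivC
  scaler0 !subr0.
Qed.

(** Characteristic 0 makes every factor i + 1 in the coefficients of p'
    invertible. *)
Lemma deriv_eq0_const p : p^`() = 0 -> p = (p.[0])%:P.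
Proof.
move=> dp0; rewrite horner_coef0; apply/polyP => -[|i]; rewrite coefC //=.
by have /eqP := coef_deriv p i; rewrite dp0 coef0 eq_sym mulrn_eq0 /= => /eqP.
Qed.

Lemma dirichlet_unique p : p^`(2) = 0 -> p.[0] = 0 -> p.[1] = 0 -> p = 0.
Proof.
rewrite derivSn derivn1 => /deriv_eq0_const; set c := _.[0] => dpE p0 p1.
have pE : p = c *: 'X.
  apply/eqP; rewrite -subr_eq0; apply/eqP.
  rewrite [LHS]deriv_eq0_const; first by rewrite !hornerE p0 subr0.
  by rewrite derivB derivZ derivX dpE alg_polyC subrr.
by move: p1; rewrite pE !hornerE => ->; rewrite scale0r.
Qed.

(** Taking two derivatives lowers the degree and preserves the hypothesis. *)
Lemma even_derivs_eq0 p :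
  (forall tau, ~~ odd tau -> p^`(tau).[0] = 0 /\ p^`(tau).[1] = 0) -> p = 0.
Proof.
have [n] := ubnP (size p); elim: n p => // n IHn p lt_pn vanish.
have [p0 p1] := vanish 0%N isT.
have [->//|p_neq0] := eqVneq p 0.
apply: dirichlet_unique => //; apply: IHn => [|tau even_tau].
  rewrite derivSn derivn1.
  apply: leq_ltn_trans (_ : size p^`() < n)%N; last first.
    exact: leq_trans (lt_size_deriv p_neq0) _.
  have [->|dp_neq0] := eqVneq p^`() 0; first by rewrite deriv0.
  exact/ltnW/lt_size_deriv.
by rewrite derivn2_derivn; apply: (vanish tau.+2); rewrite /= negbK.
Qed.

End BoundaryValue.

Section Lidstone.

Variable R : realType.
Implicit Types (p q : {poly R[i]}) (t : nat).

Lemma is_Lidstone_inj t p q : is_Lidstone t p -> is_Lidstone t q -> p = q.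
Proof.
move=> Lp Lq; apply/eqP; rewrite -subr_eq0; apply/eqP/even_derivs_eq0.
move=> tau /[dup] /Lp[p0 p1] /Lq[q0 q1].
by rewrite derivnB !hornerE p0 p1 q0 q1 !subrr.
Qed.

Lemma is_Lidstone0 : is_Lidstone 0 ('X : {poly R[i]}).
Proof.
case=> [_|[//|tau _]]; first by rewrite derivn0 !hornerX.
by rewrite !derivSn derivX derivC linear0 !horner0.
Qed.

(** The order 0 among the interpolation conditions gives the boundary values;
    the orders tau + 2 are the conditions of order tau on p''. *)
Lemma is_LidstoneSS t p :
  is_Lidstone t.+2 p <-> [/\ is_Lidstone t p^`(2), p.[0] = 0 & p.[1] = 0].
Proof.
split=> [Lp | [Lp p0 p1]].
  have [p0 p1] := Lp 0%N isT; split=> // tau even_tau.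
  by rewrite derivn2_derivn; apply: (Lp tau.+2); rewrite /= negbK.
case=> [_|[//|tau]]; first by rewrite derivn0.
by rewrite -derivn2_derivn oddS oddS negbK => /Lp.
Qed.

Lemma even_ind (P : nat -> Prop) :
  P 0%N -> (forall t, ~~ odd t -> P t -> P t.+2) ->
  forall t, ~~ odd t -> P t.
Proof.
move=> P0 PSS t /even_halfK <-; elim: t./2 => // n IHn.
by rewrite doubleS; apply: PSS; rewrite ?odd_double.
Qed.

Lemma is_Lidstone_exists t : ~~ odd t -> exists p, @is_Lidstone R t p.
Proof.
move: t; apply: even_ind => [|t _ [p Lp]].
  by exists 'X; exact: is_Lidstone0.
have [q [q2 q0 q1]] := dirichlet_exists p.
by exists q; apply/is_LidstoneSS; rewrite q2.
Qed.

Lemma LidstoneP t : ~~ odd t -> is_Lidstone t (Lidstone R t).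
Proof.
case/is_Lidstone_exists=> p Lp.
have uniq_p : unique (@is_Lidstone R t) p.
  by split=> // q; apply: is_Lidstone_inj.
by rewrite /Lidstone; case: xgetP => [q _ []//|/(_ p)].
Qed.

Lemma Lidstone_eq t p : ~~ odd t -> is_Lidstone t p -> p = Lidstone R t.
Proof. by move=> /LidstoneP Lt Lp; apply: is_Lidstone_inj Lp Lt. Qed.

Lemma Lidstone_conditions_Lidstone : Lidstone_conditions (@Lidstone R).
Proof.
split=> [|[|[|t]]// | [|[|t]]//]; first by rewrite -(Lidstone_eq _ is_Lidstone0).
- move=> even_t _; have /is_LidstoneSS[Lt _ _] := LidstoneP even_t.
  by rewrite subSS subn1 /=; apply: Lidstone_eq Lt; move: even_t; rewrite /= negbK.
- by move=> even_t _; have /is_LidstoneSS[] := LidstoneP even_t.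
Qed.

Lemma Lidstone_conditions_is_Lidstone (L : nat -> {poly R[i]}) t :
  Lidstone_conditions L -> ~~ odd t -> is_Lidstone t (L t).
Proof.
case=> L0 L2 Lbd; move: t; apply: even_ind => [|t even_t Lt].
  by rewrite L0; exact: is_Lidstone0.
have even_t2 : ~~ odd t.+2 by rewrite /= negbK.
have [L_0 L_1] := Lbd _ even_t2 isT.
by apply/is_LidstoneSS; rewrite L2 // subSS subn1.
Qed.

End Lidstone.

Theorem lemma2 (R : realType) :
  Lidstone_conditions (@Lidstone R) /\
  (forall L : nat -> {poly R[i]}, Lidstone_conditions L ->
     forall t : nat, ~~ odd t -> L t = Lidstone R t).
Proof.
split=> [|L L_cond t even_t]; first exact: Lidstone_conditions_Lidstone.
exact/Lidstone_eq/Lidstone_conditions_is_Lidstone.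
Qed.
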